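(* Consider a set of producers $\mathcal N=\{1,\dots,n\}$, quadratic production cost functions $C_i(q)=bq+c_iq^2/2$ with $b>0$ and $c_i>0$ for every $i\in\mathcal N$, and the affine demand function $D(p)=\gamma(\hat p-p)$ with $\gamma>0$, $\hat p>0$ and $\hat p\ge b$. For $K>0$, let $S^{(K)}$ be any Nash equilibrium of the $\mathrm{Lip}_K$-pay-as-bid auction game and let $p^*_K=p^*(S^{(K)})$ be its market-clearing price. Let $$p^*_\infty=\lim_{K\to+\infty}p^*_K=\frac{\hat p\gamma+b\sum_{j=1}^n1/c_j}{\gamma+\sum_{j=1}^n1/c_j}.$$ Then, for every $i\in\mathcal N$, $$\lim_{K\to+\infty}C_i'\left(S_i^{(K)}(p^*_K)\right)=p^*_\infty,$$ i.e., in the limit perfect competition (price equal to marginal costs) is achieved.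
   Context: Notation: $\mathbb R_+=[0,\infty)$; $\mathcal N$ is non-empty and finite. $\mathrm{Lip}_K$ is the set of non-decreasing functions $F:[0,\hat p]\to\mathbb R_+$ with $F(0)=0$ and $|F(x)-F(y)|\le K|x-y|$ for all $x,y\in[0,\hat p]$. The $\mathrm{Lip}_K$-pay-as-bid auction game is the strategic game with player set $\mathcal N$, where each player $i$ chooses a supply function $S_i\in\mathrm{Lip}_K$. Given $S=(S_1,\dots,S_n)$, the market-clearing price $p^*(S)$ is the unique $p^*\in[0,\hat p]$ with $D(p^* )=\sum_{i=1}^n S_i(p^* )$, and the utility of player $i$ is $$u_i(S)=p^*S_i(p^* )-\int_0^{p^*}S_i(p)\,dp-C_i(S_i(p^* )),\qquad p^*=p^*(S).$$ $S^*$ is a Nash equilibrium if for every $i$, $S_i^*$ maximizes $u_i(\cdot,S_{-i}^* )$ over $\mathrm{Lip}_K$.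
   Formalization: The claim fails for a single producer (n=b=c=γ=1, p̂=2: price tends to 5/3, marginal cost to 4/3, formula gives 3/2). Convergence of the price to the formula is proved for n≥2; for n=1 the marginal-cost limit is proved assuming that convergence. *)

(* Defs.v *)
From HB Require Import structures.
From mathcomp Require Import all_boot all_order all_algebra.
From mathcomp Require Import all_classical all_reals all_analysis.

Set Implicit Arguments.
Unset Strict Implicit.
Unset Printing Implicit Defensive.

Import Order.TTheory GRing.Theory Num.Theory.
Import numFieldNormedType.Exports.

Local Open Scope classical_set_scope.
Local Open Scope ring_scope.

(* Functions on [0, phat] are represented by functions on R whose values
   outside [0, phat] are unconstrained and never used. *)
Definition Lip (R : realType) (phat K : R) : set (R -> R) :=
  [set F | [/\ {in `[0, phat], forall x, 0 <= F x},
               {in `[0, phat] &, {homo F : x y / x <= y}},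
               F 0 = 0 &
               {in `[0, phat] &, forall x y, `|F x - F y| <= K * `|x - y|}]].

Definition affine_demand (R : realType) (gamma phat : R) : R -> R :=
  fun p => gamma * (phat - p).

Definition quadratic_cost (R : realType) (b c : R) : R -> R :=
  fun q => b * q + c * q ^+ 2 / 2.

Definition clears (R : realType) (n : nat) (phat : R) (D : R -> R)
    (S : 'I_n -> R -> R) : set R :=
  [set p | p \in `[0, phat] /\ D p = \sum_(i < n) S i p].

(* For a profile of Lip functions and a strictly decreasing continuous D with
   D phat = 0, the set [clears phat D S] is a singleton and this is its
   element; the default value 0 is then irrelevant. *)
Definition clearing_price (R : realType) (n : nat) (phat : R) (D : R -> R)
    (S : 'I_n -> R -> R) : R :=
  xget 0 (clears phat D S).

Definition utility (R : realType) (n : nat) (phat : R) (D : R -> R)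
    (C : 'I_n -> R -> R) (S : 'I_n -> R -> R) (i : 'I_n) : R :=
  let p := clearing_price phat D S in
  p * S i p - \int[lebesgue_measure]_(x in `[0, p]) S i x - C i (S i p).

Definition deviate (R : realType) (n : nat) (S : 'I_n -> R -> R) (i : 'I_n)
    (F : R -> R) : 'I_n -> R -> R :=
  fun j => if j == i then F else S j.

Definition nash_equilibrium (R : realType) (n : nat) (phat K : R) (D : R -> R)
    (C : 'I_n -> R -> R) (S : 'I_n -> R -> R) : Prop :=
  (forall i, Lip phat K (S i)) /\
  (forall i F, Lip phat K F ->
     utility phat D C (deviate S i F) i <= utility phat D C S i).

(* Main.v *)
Require Import Defs.
From HB Require Import structures.
From mathcomp Require Import all_boot all_order all_algebra.
From mathcomp Require Import all_classical all_reals all_analysis.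
From mathcomp Require Import ring lra.

Set Implicit Arguments.
Unset Strict Implicit.
Unset Printing Implicit Defensive.

Import Order.TTheory GRing.Theory Num.Theory.
Import numFieldNormedType.Exports.

Local Open Scope classical_set_scope.
Local Open Scope ring_scope.

(** At an equilibrium with clearing price [p] and quantities [q_i = S_i p],
    the argument compares price and marginal cost player by player.

    Fix a player [i]; its residual demand [r] is the demand minus the supply of
    the others.  A price [p'] with [0 <= r p' <= K p'] becomes the clearing
    price when [i] bids a function [F] of [Lip phat K] with [F p' = r p'], so
    the equilibrium condition bounds the payoff of each such deviation
    ([nash_deviation]).  Three deviations matter.
    - Slightly raising the price, with the bid capped at [r p'], shows that
      [b + c_i q_i <= p] when [q_i > 0] ([marginal_cost_le_price]).
    - Keeping the price but bidding the least admissible function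
      [x |-> max(0, q_i - K (p - x))] reduces the integral that is deducted
      from the revenue; hence the equilibrium supply is this ramp on [[0, p]]
      ([nash_supply_ramp]), and so it has left slope [K] at [p] if [q_i > 0].
    - Slightly lowering the price, with a ramp as the bid, shows that
      [p - b - c_i q_i <= q_i (1/K + 1/A)] whenever [r] increases at rate at
      least [A] to the left of [p] and [q_i < K p]
      ([price_le_marginal_cost_add]).

    With at least two players and [K > gamma phat / b], either all quantities
    are positive, and the ramp of a competitor gives [A = K]; or some
    [q_j = 0], and the third deviation with [A = gamma] gives [p <= b], which
    forces [p = phat = b] and no trade.  In both cases
    [0 <= p - (b + c_i q_i) <= 2 gamma phat / K] ([nash_margin_bounds]).
    Averaging these margins with weights [1 / c_i] through the clearing
    equation bounds [p - pinf] in the same way ([competitive_price_bounds]),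
    and both limits follow by squeezing.

    For a single player the market power does not vanish, but the assumed
    convergence of the price determines the limit of the marginal cost, because
    the only quantity is the demand itself. *)

(** * Functions of the class Lip and their integrals *)

(** The integral of [F] over the closed interval from [a] to [b]. *)
Local Notation area F a b := (\int[lebesgue_measure]_(x in `[a, b]) F x).

Lemma Lip_ge0 (R : realType) (phat K : R) (F : R -> R) (x : R) :
  Lip phat K F -> 0 <= x <= phat -> 0 <= F x.
Proof. by case=> F0 _ _ _ hx; apply: F0; rewrite in_itv. Qed.

Lemma Lip_le (R : realType) (phat K : R) (F : R -> R) (x y : R) :
  Lip phat K F -> 0 <= x -> x <= y -> y <= phat -> F x <= F y.
Proof.
case=> _ Fle _ _ x0 xy yp; apply: Fle => //; rewrite in_itv /=.
  by rewrite x0 (le_trans xy).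
by rewrite yp (le_trans x0).
Qed.

Lemma Lip_slope (R : realType) (phat K : R) (F : R -> R) (x y : R) :
  Lip phat K F -> 0 <= x -> x <= y -> y <= phat -> F y - F x <= K * (y - x).
Proof.
case=> _ _ _ FK x0 xy yp.
have := FK y x; rewrite !in_itv /= x0 yp (le_trans xy yp) (le_trans x0 xy).
move=> /(_ isT isT); rewrite (ger0_norm (_ : 0 <= y - x)) ?subr_ge0//.
by apply: le_trans; exact: ler_norm.
Qed.

(** Membership from ordered pairs of points only; nonnegativity comes from
    monotonicity and [F 0 = 0]. *)
Lemma Lip_intro (R : realType) (phat K : R) (F : R -> R) :
  (forall x y, 0 <= x -> x <= y -> y <= phat ->
     F x <= F y /\ F y - F x <= K * (y - x)) ->
  F 0 = 0 -> Lip phat K F.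
Proof.
move=> FP F00; split => //.
- move=> x; rewrite in_itv /= => /andP[x0 xp].
  by rewrite -F00; have [] := FP 0 x (lexx 0) x0 xp.
- move=> x y; rewrite !in_itv /= => /andP[x0 _] /andP[_ yp] xy.
  by have [] := FP x y x0 xy yp.
- move=> x y; rewrite !in_itv /= => /andP[x0 xp] /andP[y0 yp].
  wlog xy : x y x0 xp y0 yp / x <= y.
    move=> H; have [xy|/ltW xy] := leP x y; first exact: H.
    by rewrite distrC (distrC x); exact: H.
  have [h1 h2] := FP x y x0 xy yp.
  by rewrite distrC (distrC x) !ger0_norm ?subr_ge0.
Qed.

Lemma Lip_cst0 (R : realType) (phat K : R) : 0 <= K -> Lip phat K (cst 0).
Proof.
move=> K0; apply: Lip_intro => // x y _ xy _; split=> //=.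
by rewrite subrr mulr_ge0// subr_ge0.
Qed.

Lemma Lip_minr (R : realType) (phat K q : R) (F : R -> R) :
  0 <= K -> 0 <= q -> Lip phat K F -> Lip phat K (fun x => Num.min (F x) q).
Proof.
move=> K0 q0 LF; apply: Lip_intro => [x y x0 xy yp|]; last first.
  by case: LF => _ _ -> _; apply/min_idPl.
have h1 := Lip_le LF x0 xy yp.
have h2 := Lip_slope LF x0 xy yp.
have h3 : 0 <= K * (y - x) by rewrite mulr_ge0// subr_ge0.
by case: (leP (F x) q); case: (leP (F y) q) => *; split; lra.
Qed.

(** For [0 <= q <= K * p], the least function on [[0, p]] among those of
    [Lip phat K] with value [q] at [p].  Beyond [p] it keeps the slope [K], an
    arbitrary choice that does not affect the market. *)
Definition ramp (R : realType) (K p q : R) : R -> R :=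
  fun x => Num.max 0 (q - K * (p - x)).

Lemma Lip_ramp (R : realType) (phat K p q : R) :
  0 <= K -> q <= K * p -> Lip phat K (ramp K p q).
Proof.
move=> K0 qKp; apply: Lip_intro => [x y x0 xy yp|]; last first.
  by rewrite /ramp; apply/max_idPl; lra.
have h3 : 0 <= K * (y - x) by rewrite mulr_ge0// subr_ge0.
rewrite /ramp.
case: (leP 0 (q - K * (p - x))); case: (leP 0 (q - K * (p - y))) => *;
  split; lra.
Qed.

Lemma ramp_end (R : realType) (K p q : R) : 0 <= q -> ramp K p q p = q.
Proof. by move=> q0; rewrite /ramp subrr mulr0 subr0; apply/max_idPr. Qed.

Lemma Lip_within_continuous (R : realType) (phat K : R) (F : R -> R) (a b : R) :
  0 <= K -> Lip phat K F -> 0 <= a -> b <= phat ->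
  {within `[a, b], continuous F}.
Proof.
move=> K0 [_ _ _ FK] a0 bp.
apply/subspace_continuousP => x /=; rewrite in_itv /= => /andP[ax xb].
apply/cvgrPdist_lt => e e0.
rewrite near_withinE.
have d0 : 0 < e / (K + 1) by rewrite divr_gt0// ltr_wpDl.
near=> y; rewrite /= in_itv /= => /andP[ay yb].
have h : `|x - y| < e / (K + 1).
  by near: y; exact: (@cvgr_dist_lt _ _ _ _ _ idfun x).
apply: (@le_lt_trans _ _ (K * `|x - y|)).
  by apply: FK; rewrite in_itv /=; lra.
move: h; rewrite ltr_pdivlMr ?ltr_wpDl//.
have := normr_ge0 (x - y); lra.
Unshelve. all: by end_near. Qed.

Lemma Lip_integrable (R : realType) (phat K : R) (F : R -> R) (a b : R) :
  0 <= K -> Lip phat K F -> 0 <= a -> b <= phat ->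
  lebesgue_measure.-integrable `[a, b] (EFin \o F).
Proof.
move=> K0 LF a0 bp; apply: continuous_compact_integrable.
  exact: segment_compact.
exact: (Lip_within_continuous K0 LF).
Qed.

Lemma area_split (R : realType) (phat K : R) (F : R -> R) (a m b : R) :
  0 <= K -> Lip phat K F -> 0 <= a -> a <= m -> m <= b -> b <= phat ->
  area F a b = area F a m + area F m b.
Proof.
move=> K0 LF a0 am mb bp.
have iF := Lip_integrable K0 LF a0 bp.
have := @Rintegral_itvB R F (BLeft a) (BRight b) m iF.
rewrite !bnd_simp => /(_ am mb).
rewrite Rintegral_itv_obnd_cbnd; first by move=> <-; ring.
apply: integrableS (Lip_integrable K0 LF (le_trans a0 am) bp) => //.
by apply: subset_itvr; rewrite bnd_simp.
Qed.

(** Comparison of integrals up to an additive constant [d], of any sign. *)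
Lemma le_area (R : realType) (phat K d : R) (F G : R -> R) (a b : R) :
  0 <= K -> Lip phat K F -> Lip phat K G -> 0 <= a -> a <= b -> b <= phat ->
  (forall x, a <= x <= b -> F x <= G x + d) ->
  area F a b <= area G a b + d * (b - a).
Proof.
move=> K0 LF LG a0 ab bp FG.
have iF := Lip_integrable K0 LF a0 bp.
have iG := Lip_integrable K0 LG a0 bp.
have mu_ab : lebesgue_measure (`[a, b] : set R) = (b - a)%:E.
  by rewrite lebesgue_measure_itv /= lte_fin; case: ltgtP ab => // -> ;
     rewrite subrr.
have iC : lebesgue_measure.-integrable (`[a, b] : set R) (EFin \o cst d).
  apply: continuous_compact_integrable; first exact: segment_compact.
  by apply: continuous_subspaceT => x; exact: cvg_cst.
have -> : d * (b - a) = area (cst d) a b.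
  by rewrite Rintegral_cst//= mu_ab.
rewrite -RintegralD//; apply: le_Rintegral => //.
by apply: eq_integrable (integrableD _ iG iC).
Qed.

(** * Market clearing and unilateral deviations *)

Lemma Lip_sum (R : realType) (n : nat) (phat K : R) (S : 'I_n -> R -> R)
    (P : pred 'I_n) :
  (forall i, Lip phat K (S i)) ->
  Lip phat (\sum_(j < n | P j) K) (fun x => \sum_(j < n | P j) S j x).
Proof.
move=> LS; apply: Lip_intro => [x y x0 xy yp|]; last first.
  by apply: big1 => j _; case: (LS j).
split; first by apply: ler_sum => j _; exact: (Lip_le (LS j)).
rewrite -sumrB mulr_suml; apply: ler_sum => j _; exact: (Lip_slope (LS j)).
Qed.

(** The quantity left to player [i] at each price when the others bid [S]. *)
Definition residual (R : realType) (n : nat) (gamma phat : R)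
    (S : 'I_n -> R -> R) (i : 'I_n) : R -> R :=
  fun p => affine_demand gamma phat p - \sum_(j < n | j != i) S j p.

Lemma residual_decr (R : realType) (n : nat) (gamma phat K : R)
    (S : 'I_n -> R -> R) (i : 'I_n) (x y : R) :
  (forall j, Lip phat K (S j)) -> 0 <= x -> x <= y -> y <= phat ->
  gamma * (y - x) <= residual gamma phat S i x - residual gamma phat S i y
    <= (gamma + \sum_(j < n | j != i) K) * (y - x).
Proof.
move=> LS x0 xy yp; have LT := Lip_sum (fun j => j != i) LS.
have := Lip_le LT x0 xy yp; have := Lip_slope LT x0 xy yp.
rewrite /residual /affine_demand; lra.
Qed.

Lemma clearsE (R : realType) (n : nat) (gamma phat p : R)
    (S : 'I_n -> R -> R) (i : 'I_n) :
  clears phat (affine_demand gamma phat) S p <->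
  0 <= p <= phat /\ S i p = residual gamma phat S i p.
Proof.
rewrite /clears /= in_itv /= (bigD1 i)//= /residual.
by split=> -[-> h]; split=> //; move: h; lra.
Qed.

Lemma clears_unique (R : realType) (n : nat) (gamma phat K p p' : R)
    (S : 'I_n -> R -> R) :
  0 < gamma -> (forall i, Lip phat K (S i)) ->
  clears phat (affine_demand gamma phat) S p ->
  clears phat (affine_demand gamma phat) S p' -> p' = p.
Proof.
move=> g0 LS; rewrite /clears /= !in_itv /= /affine_demand.
wlog pp : p p' / p <= p'.
  move=> H h h'; have [pp|/ltW pp] := leP p p'; first exact: H.
  by apply/esym/H.
move=> [/andP[p0 _] h] [/andP[_ p1] h'].
have := Lip_le (Lip_sum predT LS) p0 pp p1; rewrite -h -h' ler_pM2l//.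
lra.
Qed.

Lemma clearing_price_eq (R : realType) (n : nat) (gamma phat K p : R)
    (S : 'I_n -> R -> R) :
  0 < gamma -> (forall i, Lip phat K (S i)) ->
  clears phat (affine_demand gamma phat) S p ->
  clearing_price phat (affine_demand gamma phat) S = p.
Proof.
by move=> g0 LS h; apply: xget_unique => // p'; exact: (clears_unique g0 LS).
Qed.

Lemma clearing_price_clears (R : realType) (n : nat) (gamma phat K : R)
    (S : 'I_n -> R -> R) :
  0 < gamma -> 0 <= phat -> 0 <= K -> (forall i, Lip phat K (S i)) ->
  clears phat (affine_demand gamma phat) S
    (clearing_price phat (affine_demand gamma phat) S).
Proof.
move=> g0 phat0 K0 LS.
have LT := Lip_sum predT LS.
have K'0 : 0 <= \sum_(j < n) K + gamma.
  by rewrite addr_ge0 ?(ltW g0)// sumr_ge0.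
(* The clearing equation reads [\sum_j S_j p + gamma * p = gamma * phat], and
   its left-hand side is again a function of class Lip. *)
have LG : Lip phat (\sum_(j < n) K + gamma)
    (fun x => \sum_(j < n) S j x + gamma * x).
  apply: Lip_intro => [x y x0 xy yp|]; last by case: LT => _ _ -> _; lra.
  have := Lip_le LT x0 xy yp; have := Lip_slope LT x0 xy yp.
  have : 0 <= gamma * (y - x) by rewrite mulr_ge0 ?subr_ge0 ?(ltW g0).
  by move=> *; split; lra.
have cG := Lip_within_continuous K'0 LG (lexx 0) (lexx phat).
have [|p p01 hp] := @IVT _ _ _ _ (gamma * phat) phat0 cG.
  have T0 : \sum_(j < n) S j 0 = 0 by case: LT.
  rewrite T0 mulr0 addr0.
  have h : 0 <= \sum_(j < n) S j phat.
    by apply: (Lip_ge0 LT); rewrite phat0 lexx.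
  have h2 : 0 <= gamma * phat by rewrite mulr_ge0// ltW.
  by rewrite ge_min le_max h2 /= lerDr h orbT.
apply: xgetPex; exists p; split=> //; rewrite /affine_demand.
by move: hp => /=; lra.
Qed.

Lemma deviate_Lip (R : realType) (n : nat) (phat K : R) (S : 'I_n -> R -> R)
    (i : 'I_n) (F : R -> R) :
  (forall j, Lip phat K (S j)) -> Lip phat K F ->
  forall j, Lip phat K (deviate S i F j).
Proof. by move=> LS LF j; rewrite /deviate; case: ifP. Qed.

Lemma utility_deviate (R : realType) (n : nat) (gamma phat K p : R)
    (C S : 'I_n -> R -> R) (i : 'I_n) (F : R -> R) :
  0 < gamma -> (forall j, Lip phat K (S j)) -> Lip phat K F ->
  0 <= p <= phat -> F p = residual gamma phat S i p ->
  utility phat (affine_demand gamma phat) C (deviate S i F) i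
  = p * F p - area F 0 p - C i (F p).
Proof.
move=> g0 LS LF pI Fp; rewrite /utility.
rewrite (clearing_price_eq g0 (deviate_Lip i LS LF) (p := p)).
  by rewrite /deviate eqxx.
apply/(clearsE _ _ _ _ i); split=> //; rewrite /deviate eqxx Fp /residual.
by congr (_ - _); apply: eq_bigr => j /negPf ->.
Qed.

(** Equilibrium condition for a deviation [F] of player [i] which moves the
    clearing price to [p]. *)
Lemma nash_deviation (R : realType) (n : nat) (gamma phat K p : R)
    (C S : 'I_n -> R -> R) (i : 'I_n) (F : R -> R) :
  0 < gamma -> 0 <= phat -> 0 <= K ->
  nash_equilibrium phat K (affine_demand gamma phat) C S ->
  let p0 := clearing_price phat (affine_demand gamma phat) S in
  Lip phat K F -> 0 <= p <= phat -> F p = residual gamma phat S i p ->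
  p * F p - area F 0 p - C i (F p)
  <= p0 * S i p0 - area (S i) 0 p0 - C i (S i p0).
Proof.
move=> g0 phat0 K0 [LS NS] p0 LF pI Fp.
by rewrite -(utility_deviate C g0 LS LF pI Fp); exact: NS.
Qed.

(** * Marginal cost and price at an equilibrium *)

Lemma le_of_small (R : realType) (x y M e0 : R) :
  0 < e0 -> 0 <= M -> (forall e, 0 < e -> e < e0 -> x <= y + M * e) -> x <= y.
Proof.
move=> e00 M0 H; apply/ler_addgt0Pr => d d0.
set e := Num.min (e0 / 2) (d / (M + 1)).
have M1 : 0 < M + 1 by lra.
have e_gt0 : 0 < e by rewrite lt_min !divr_gt0.
have e_lt : e < e0.
  by rewrite (@le_lt_trans _ _ (e0 / 2)) ?ge_min ?lexx//; lra.
have : e * (M + 1) <= d by rewrite -ler_pdivlMr// ge_min lexx orbT.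
have := H e e_gt0 e_lt; lra.
Qed.

Lemma area_cst0 (R : realType) (a b : R) : area (cst 0) a b = 0.
Proof. by rewrite Rintegral_cst//= mul0r. Qed.

(** A producing player never sells below marginal cost: otherwise capping its
    supply, which raises the price, would be profitable. *)
Lemma marginal_cost_le_price (R : realType) (n : nat) (b gamma phat K : R)
    (c : 'I_n -> R) (S : 'I_n -> R -> R) (i : 'I_n) :
  0 < gamma -> 0 <= phat -> 0 <= K -> 0 <= c i ->
  nash_equilibrium phat K (affine_demand gamma phat)
    (fun j => quadratic_cost b (c j)) S ->
  let p := clearing_price phat (affine_demand gamma phat) S in
  0 < S i p -> b + c i * S i p <= p.
Proof.
move=> g0 phat0 K0 ci0 NE p q0.
have LS := NE.1.
have [/andP[p0 pp] qE] := (clearsE _ _ _ _ i).1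
  (clearing_price_clears g0 phat0 K0 LS).
rewrite -/p in p0 pp qE.
set q := S i p in q0 qE *.
set M := gamma + \sum_(j < n | j != i) K.
have M0 : 0 < M by rewrite ltr_wpDr// sumr_ge0.
have rphat : residual gamma phat S i phat <= 0.
  rewrite /residual /affine_demand subrr mulr0 sub0r oppr_le0.
  by apply: (Lip_ge0 (Lip_sum _ LS)); rewrite phat0 lexx.
(* A higher price [p + e] is available since demand is positive at [p]. *)
have p_lt : p < phat.
  rewrite lt_neqAle pp andbT; apply/eqP => pE.
  by move: rphat; rewrite -{2}pE -qE leNgt q0.
apply: (@le_of_small _ _ _ (c i * M / 2) (Num.min (phat - p) (q / M))).
- by rewrite lt_min subr_gt0 p_lt divr_gt0.
- by rewrite divr_ge0// mulr_ge0// ltW.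
move=> e e0; rewrite lt_min ltr_pdivlMr// => /andP[e1 e2].
have p'I : 0 <= p + e <= phat by lra.
have [p'0 p'1] := andP p'I.
have pp' : p <= p + e by lra.
have /andP[d1 d2] := residual_decr gamma i LS p0 pp' p'1.
rewrite -/M -qE in d1 d2.
set q' := residual gamma phat S i (p + e) in d1 d2.
have eg : 0 < gamma * e by rewrite mulr_gt0.
have q'0 : 0 <= q' by lra.
have qq' : q' < q by lra.
have LF : Lip phat K (fun x => Num.min (S i x) q') by apply: Lip_minr.
have FE : Num.min (S i (p + e)) q' = q'.
  apply/min_idPr; apply: le_trans (ltW qq') _.
  exact: (Lip_le (LS i) p0 pp' p'1).
have := nash_deviation g0 phat0 K0 NE LF p'I FE.
rewrite /= FE -/p -/q (area_split K0 LF (lexx 0) p0 pp' p'1).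
have h1 : area (fun x => Num.min (S i x) q') 0 p
    <= area (S i) 0 p + 0 * (p - 0).
  apply: (le_area K0 LF (LS i)) => // x _.
  by rewrite addr0 ge_min lexx.
have h2 : area (fun x => Num.min (S i x) q') p (p + e)
    <= area (cst 0) p (p + e) + q' * (p + e - p).
  apply: (le_area K0 LF (Lip_cst0 _ K0)) => // x _.
  by rewrite add0r ge_min lexx orbT.
rewrite area_cst0 in h2.
rewrite /quadratic_cost => h3.
have h4 : (q - q') * (c i * (q + q') / 2) <= (q - q') * (p - b) by lra.
rewrite ler_pM2l ?subr_gt0// in h4.
have h5 : c i * (q - q') <= c i * (M * e) by apply: ler_wpM2l => //; lra.
lra.
Qed.

(** Minimality of the ramp on [[0, p]]. *)
Lemma ramp_le (R : realType) (phat K p q x : R) (F : R -> R) :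
  Lip phat K F -> 0 <= x -> x <= p -> p <= phat -> q <= F p ->
  ramp K p q x <= F x.
Proof.
move=> LF x0 xp pp qF; rewrite /ramp ge_max (Lip_ge0 LF) ?x0 ?(le_trans xp)//=.
have := Lip_slope LF x0 xp pp; lra.
Qed.

(** Up to the clearing price an equilibrium supply is the ramp through its
    traded quantity: any other supply gives a larger integral to deduct. *)
Lemma nash_supply_ramp (R : realType) (n : nat) (gamma phat K : R)
    (C S : 'I_n -> R -> R) (i : 'I_n) (x : R) :
  0 < gamma -> 0 <= phat -> 0 < K ->
  nash_equilibrium phat K (affine_demand gamma phat) C S ->
  let p := clearing_price phat (affine_demand gamma phat) S in
  0 <= x -> x <= p -> S i x = ramp K p (S i p) x.
Proof.
move=> g0 phat0 K_gt0 NE p x0 xp.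
have K0 := ltW K_gt0.
have LS := NE.1.
have [/andP[p0 pp] qE] := (clearsE _ _ _ _ i).1
  (clearing_price_clears g0 phat0 K0 LS).
rewrite -/p in p0 pp qE.
have q0 : 0 <= S i p by apply: (Lip_ge0 (LS i)); rewrite p0.
set q := S i p in q0 qE *.
have qKp : q <= K * p.
  have := Lip_slope (LS i) (lexx 0) p0 pp.
  by case: (LS i) => _ _ -> _; rewrite !subr0.
have LL := Lip_ramp phat K0 qKp.
have LE := ramp_end K p q0.
have pI : 0 <= p <= phat by rewrite p0.
have := nash_deviation g0 phat0 K0 NE LL pI (etrans LE qE).
rewrite /= LE -/p -/q => h.
have leL y : 0 <= y -> y <= p -> ramp K p q y <= S i y.
  by move=> y0 yp; exact: (ramp_le (LS i)).
apply/eqP; rewrite eq_le leL// andbT leNgt; apply/negP => hx.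
set eta := S i x - ramp K p q x.
have eta0 : 0 < eta by rewrite subr_gt0.
have x_gt0 : 0 < x.
  rewrite lt_neqAle x0 andbT; apply/eqP => x00; move: hx; rewrite -x00.
  by case: (LS i) => _ _ -> _; rewrite /ramp gt_max ltxx.
(* The slope bound keeps the gap at least [eta / 2] on [[x - t, x]], so the
   integrals would differ by a positive amount. *)
set t := Num.min x (eta / (2 * K)).
have t0 : 0 < t by rewrite lt_min x_gt0 divr_gt0// mulr_gt0.
have tx : t <= x by rewrite ge_min lexx.
have tK : K * t <= eta / 2.
  rewrite mulrC -ler_pdivlMr// ge_min; apply/orP; right.
  by rewrite invfM mulrA.
have xt0 : 0 <= x - t by rewrite subr_ge0.
have xtp : x - t <= p by lra.
have xtx : x - t <= x by lra.
have xph := le_trans xp pp.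
have tpp := le_trans xtp pp.
move: h; rewrite (area_split K0 LL (lexx 0) xt0 xtp pp).
rewrite (area_split K0 LL xt0 xtx xp pp).
rewrite (area_split K0 (LS i) (lexx 0) xt0 xtp pp).
rewrite (area_split K0 (LS i) xt0 xtx xp pp).
have h1 : area (ramp K p q) 0 (x - t)
    <= area (S i) 0 (x - t) + 0 * (x - t - 0).
  by apply: (le_area K0 LL (LS i)) => // y yI; rewrite addr0 leL; lra.
have h3 : area (ramp K p q) x p <= area (S i) x p + 0 * (p - x).
  by apply: (le_area K0 LL (LS i)) => // y yI; rewrite addr0 leL; lra.
have h2 : area (ramp K p q) (x - t) x
    <= area (S i) (x - t) x + (- (eta / 2)) * (x - (x - t)).
  apply: (le_area K0 LL (LS i)) => // y /andP[y1 y2].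
  have y0 := le_trans xt0 y1.
  have := Lip_le LL y0 y2 xph; have := Lip_slope (LS i) y0 y2 xph.
  have : K * (x - y) <= K * t by apply: ler_wpM2l => //; lra.
  rewrite /eta in tK *; lra.
have : 0 < eta / 2 * t by rewrite mulr_gt0 ?divr_gt0.
lra.
Qed.

(** Upper bound on the margin, by the deviation that lowers the price to [p - e]
    and sells the residual demand there along a ramp.  [A] is a lower bound for
    the rate at which residual demand grows as the price falls below [p]. *)
Lemma price_le_marginal_cost_add (R : realType) (n : nat)
    (b gamma phat K A e0 : R) (c : 'I_n -> R) (S : 'I_n -> R -> R) (i : 'I_n) :
  0 < gamma -> 0 < phat -> 0 < K -> 0 <= c i -> 0 < A -> 0 < e0 ->
  nash_equilibrium phat K (affine_demand gamma phat)
    (fun j => quadratic_cost b (c j)) S ->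
  let p := clearing_price phat (affine_demand gamma phat) S in
  S i p < K * p ->
  (forall e, 0 < e -> e < e0 -> e <= p ->
     A * e <= residual gamma phat S i (p - e) - residual gamma phat S i p) ->
  p <= b + c i * S i p + S i p * (K^-1 + A^-1).
Proof.
move=> g0 phat_gt0 K_gt0 ci0 A0 e00 NE p qKp HA.
have K0 := ltW K_gt0.
have phat0 := ltW phat_gt0.
have LS := NE.1.
have [/andP[p0 pp] qE] := (clearsE _ _ _ _ i).1
  (clearing_price_clears g0 phat0 K0 LS).
rewrite -/p in p0 pp qE.
have q0 : 0 <= S i p by apply: (Lip_ge0 (LS i)); rewrite p0.
set q := S i p in q0 qE qKp *.
have p_gt0 : 0 < p by rewrite -(pmulr_rgt0 _ K_gt0) (le_lt_trans q0).
set M := gamma + \sum_(j < n | j != i) K.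
have M0 : 0 < M by rewrite ltr_wpDr// sumr_ge0.
have kK : K * K^-1 = 1 by rewrite mulfV// gt_eqF.
have aA : A * A^-1 = 1 by rewrite mulfV// gt_eqF.
set k := K^-1 in kK *; set a := A^-1 in aA *.
have k0 : 0 < k by rewrite invr_gt0.
have a0 : 0 < a by rewrite invr_gt0.
have MK0 : 0 < M + K by lra.
apply: (@le_of_small _ _ _ (1 + K * a + (k + a) * M + c i * M / 2)
  (Num.min e0 (Num.min p ((K * p - q) / (M + K))))).
- by rewrite !lt_min e00 p_gt0 divr_gt0// subr_gt0.
- by clearbody M k a; rewrite ?(addr_ge0, mulr_ge0, invr_ge0)// ?ltW.
move=> e e_gt0; rewrite !lt_min ltr_pdivlMr// => /and3P[e1 e2 e3].
have {}HA := HA e e_gt0 e1 (ltW e2).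
have p'I : 0 <= p - e <= phat by lra.
have [p'0 p'1] := andP p'I.
have pp' : p - e <= p by lra.
have /andP[_ d2] := residual_decr gamma i LS p'0 pp' pp.
rewrite -/M -qE in d2; rewrite -qE in HA.
set q' := residual gamma phat S i (p - e) in d2 HA.
set d := q' - q in d2 HA.
have Ae0 : 0 < A * e by rewrite mulr_gt0.
have q'0 : 0 <= q' by rewrite /d in HA; lra.
have q'K : q' <= K * (p - e) by rewrite /d in d2; lra.
have LF := Lip_ramp phat K0 q'K.
have FE := ramp_end K (p - e) q'0.
have := nash_deviation g0 phat0 K0 NE LF p'I FE.
rewrite /= FE -/p -/q (area_split K0 (LS i) (lexx 0) p'0 pp' pp).
have q'k : K * (q' * k) = q' by rewrite mulrCA kK mulr1.
have q'k0 : 0 <= q' * k by rewrite mulr_ge0// ltW.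
have q'kp : q' * k <= p - e by rewrite -(ler_pM2l K_gt0) q'k.
have t0 : 0 <= p - e - q' * k by rewrite subr_ge0.
have tp : p - e - q' * k <= p - e by lra.
have tpp := le_trans tp p'1.
(* The ramp vanishes up to [p - e - q' / K], and from there to [p - e] it
   exceeds the equilibrium supply by at most [d + K * e]. *)
have h1 : area (ramp K (p - e) q') 0 (p - e - q' * k)
    <= area (S i) 0 (p - e - q' * k) + 0 * (p - e - q' * k - 0).
  apply: (le_area K0 LF (LS i)) => // x /andP[x0 xt].
  have Sx0 : 0 <= S i x by apply: (Lip_ge0 (LS i)); rewrite x0 (le_trans xt).
  have : K * (q' * k) <= K * (p - e - x) by rewrite ler_pM2l//; lra.
  rewrite q'k addr0 /ramp ge_max Sx0 /=; lra.
have Ke0 : 0 < K * e by rewrite mulr_gt0.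
have h2 : area (ramp K (p - e) q') (p - e - q' * k) (p - e)
    <= area (S i) (p - e - q' * k) (p - e)
       + (d + K * e) * (p - e - (p - e - q' * k)).
  apply: (le_area K0 LF (LS i)) => // x /andP[xt xp'].
  have x0 := le_trans t0 xt.
  have Sx0 : 0 <= S i x.
    by apply: (Lip_ge0 (LS i)); rewrite x0 (le_trans xp').
  rewrite /ramp ge_max; apply/andP; split; first lra.
  have := Lip_slope (LS i) x0 (le_trans xp' pp') pp.
  by rewrite -/q /d; lra.
have h3 : area (cst 0) (p - e) p
    <= area (S i) (p - e) p + (- (q - K * e)) * (p - (p - e)).
  apply: (le_area K0 (Lip_cst0 _ K0) (LS i)) => // x /andP[xt xp'].
  have := Lip_slope (LS i) (le_trans p'0 xt) xp' pp; rewrite -/q.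
  have : K * (p - x) <= K * e by apply: ler_wpM2l => //; lra.
  by rewrite /=; lra.
rewrite area_cst0 in h3.
rewrite (area_split K0 LF (lexx 0) t0 tp p'1).
rewrite (area_split K0 (LS i) (lexx 0) t0 tp p'1).
rewrite /quadratic_cost => h4.
have q'E : q' = q + d by rewrite /d; ring.
have h5 : d * (p - b - c i * q) <= e * d + K * e * e
    + (d + K * e) * ((q + d) * k) + c i * d * d / 2.
  by clear -h1 h2 h3 h4 q'E; rewrite q'E in h1 h2 h3 h4; lra.
(* Dividing by [d] requires [e] to be small compared with [d]. *)
have ead : e <= a * d.
  by rewrite -[e]mul1r -aA -mulrA mulrCA ler_pM2l.
have d0 : 0 < d by lra.
have Kk : K * e * ((q + d) * k) = e * (q + d).
  by rewrite -[RHS]mul1r -kK; ring.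
have h6 : d * (p - b - c i * q)
    <= d * (e + K * a * e + (k + a) * (q + d) + c i * d / 2).
  apply: le_trans h5 _; rewrite [(d + _) * _]mulrDl Kk.
  have : K * e * e <= K * e * (a * d) by rewrite ler_pM2l.
  have : e * (q + d) <= (a * d) * (q + d) by apply: ler_wpM2r => //; lra.
  lra.
rewrite ler_pM2l// in h6.
have : (k + a) * d <= (k + a) * (M * e) by rewrite ler_pM2l//; lra.
have : c i * d <= c i * (M * e) by apply: ler_wpM2l => //; lra.
lra.
Qed.

(** Margins are nonnegative and of order [1 / K] as soon as there are two
    players.  The assumption [gamma * phat < K * b] ensures [S i p < K * p], so
    that a slightly larger quantity remains admissible at a slightly lower
    price. *)
Lemma nash_margin_bounds (R : realType) (n : nat) (b gamma phat K : R)
    (c : 'I_n -> R) (S : 'I_n -> R -> R) (i : 'I_n) :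
  (1 < n)%N -> 0 < b -> (forall j, 0 < c j) -> 0 < gamma -> 0 < phat ->
  b <= phat -> 0 < K -> gamma * phat < K * b ->
  nash_equilibrium phat K (affine_demand gamma phat)
    (fun j => quadratic_cost b (c j)) S ->
  let p := clearing_price phat (affine_demand gamma phat) S in
  0 <= p - (b + c i * S i p) <= 2 * (gamma * phat) / K.
Proof.
move=> n1 b0 c0 g0 phat_gt0 bphat K_gt0 Kb NE /=; set p := clearing_price _ _ _.
have K0 := ltW K_gt0; have phat0 := ltW phat_gt0.
have LS := NE.1.
have [pI hD] := clearing_price_clears g0 phat0 K0 LS.
have /andP[p0 pp] : 0 <= p <= phat by rewrite in_itv in pI.
rewrite -/p in hD; clear pI.
have q0 j : 0 <= S j p by apply: (Lip_ge0 (LS j)); rewrite p0.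
have gp0 : 0 <= gamma * p by rewrite mulr_ge0// ltW.
have gphat0 : 0 < gamma * phat by rewrite mulr_gt0.
have q_le j : S j p <= gamma * phat.
  have : 0 <= \sum_(l < n | l != j) S l p by apply: sumr_ge0.
  by move: hD; rewrite (bigD1 j)//= /affine_demand; lra.
have p_gt0 : 0 < p.
  rewrite lt_neqAle p0 andbT; apply/eqP => p00.
  move: hD; rewrite -p00 big1; last by move=> j _; case: (LS j).
  by rewrite /affine_demand; lra.
have lower j : 0 < S j p -> b + c j * S j p <= p.
  exact: marginal_cost_le_price g0 phat0 K0 (ltW (c0 j)) NE.
have qKp j : S j p < K * p.
  have := q0 j; rewrite le_eqVlt => /orP[/eqP <-|qj]; first by rewrite mulr_gt0.
  have cq : 0 < c j * S j p by rewrite mulr_gt0.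
  apply: le_lt_trans (q_le j) (lt_le_trans Kb _).
  by rewrite ler_pM2l//; have := lower j qj; lra.
(* Residual demand grows at least as much as demand plus one competitor's cut. *)
have res_le j e : 0 < e -> e <= p -> forall l, l != j ->
    gamma * e + (S l p - S l (p - e))
    <= residual gamma phat S j (p - e) - residual gamma phat S j p.
  move=> e0 ep l lj; rewrite /residual /affine_demand.
  rewrite [X in _ <= _ - X - _](bigD1 l)//=.
  rewrite [X in _ <= _ - _ - (_ - X)](bigD1 l)//=.
  have : \sum_(m < n | (m != j) && (m != l)) S m (p - e)
      <= \sum_(m < n | (m != j) && (m != l)) S m p.
    by apply: ler_sum => m _; apply: (Lip_le (LS m)); lra.
  lra.
have other (j : 'I_n) : exists l, l != j.
  have : (0 < #|predC1 j|)%N by rewrite cardC1 card_ord; case: (n) n1 => [|[]].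
  by case/card_gt0P => l lj; exists l.
(* If some player sells nothing, then [p <= b], so nobody sells. *)
have [/existsP[j /eqP qj]|/existsPn q_neq0] := boolP [exists j, S j p == 0].
  have pb : p <= b.
    have := price_le_marginal_cost_add g0 phat_gt0 K_gt0 (ltW (c0 j)) g0 ltr01 NE
      (qKp j).
    rewrite -/p qj mulr0 mul0r !addr0; apply=> e e0 _ ep.
    have [l lj] := other j.
    apply: le_trans (res_le j e e0 ep l lj).
    by rewrite lerDl subr_ge0; apply: (Lip_le (LS l)); lra.
  have q_eq0 l : S l p = 0.
    apply/eqP; rewrite eq_le q0 andbT leNgt; apply/negP => ql.
    have : 0 < c l * S l p by rewrite mulr_gt0.
    by have := lower l ql; lra.
  have : gamma * (phat - p) = 0.
    by move: hD; rewrite big1.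
  move/eqP; rewrite mulf_eq0 gt_eqF//= subr_eq0 => /eqP pE.
  rewrite q_eq0 mulr0 addr0 subr_ge0 -{1}pE bphat /=.
  apply: (@le_trans _ _ 0); first by rewrite subr_le0.
  by rewrite divr_ge0// mulr_ge0// ltW.
have q_gt0 j : 0 < S j p by rewrite lt_neqAle q0 eq_sym q_neq0.
rewrite subr_ge0 lower//=.
(* The supply of a competitor [j] decreases at rate [K] to the left of [p] as
   long as it stays positive, i.e. for [e < q_j / K]. *)
have [j ji] := other i.
have H : p <= b + c i * S i p + S i p * (K^-1 + K^-1).
  apply: (price_le_marginal_cost_add g0 phat_gt0 K_gt0 (ltW (c0 i)) K_gt0
    (divr_gt0 (q_gt0 j) K_gt0) NE (qKp i)) => e e0.
  rewrite ltr_pdivlMr// => eK ep.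
  apply: le_trans (res_le i e e0 ep j ji).
  have pe0 : 0 <= p - e by rewrite subr_ge0.
  have pep : p - e <= p by lra.
  rewrite (nash_supply_ramp j g0 phat0 K_gt0 NE pe0 pep) -/p /ramp.
  rewrite (_ : Num.max 0 _ = S j p - K * e); last first.
    by rewrite (_ : p - (p - e) = e); [apply/max_idPr; lra | ring].
  have : 0 < gamma * e by rewrite mulr_gt0.
  lra.
have : S i p * K^-1 <= gamma * phat * K^-1 by rewrite ler_pM2r ?invr_gt0.
lra.
Qed.

Lemma derive1_quadratic_cost (R : realType) (b c q : R) :
  derive1 (quadratic_cost b c) q = b + c * q.
Proof.
have D : is_derive q 1 (fun x : R => b * x + (c / 2) * x ^+ 2)
    (b * 1 + (c / 2) * (2 * q)).
  apply: is_derive_eq; rewrite /GRing.scale /=; ring.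
have -> : quadratic_cost b c = (fun x : R => b * x + (c / 2) * x ^+ 2).
  by apply/funext => x; rewrite /quadratic_cost; ring.
by rewrite derive1E; case: D => _ ->; field.
Qed.

(** * Convergence to the competitive price *)

(** If all margins lie in [[0, E]], so does the gap between the clearing price
    and the competitive price: it is the average of the margins with weights
    [1 / c j], and weight [gamma] on [0]. *)
Lemma competitive_price_bounds (R : realType) (n : nat) (b gamma phat p E : R)
    (c q : 'I_n -> R) :
  0 < gamma -> (forall j, 0 < c j) -> 0 <= E ->
  gamma * (phat - p) = \sum_(j < n) q j ->
  (forall j, 0 <= p - (b + c j * q j) <= E) ->
  0 <= p - (phat * gamma + b * \sum_(j < n) 1 / c j)
           / (gamma + \sum_(j < n) 1 / c j) <= E.
Proof.
move=> g0 c0 E0 hD he.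
set s := \sum_(j < n) 1 / c j.
have s0 : 0 <= s by apply: sumr_ge0 => j _; rewrite divr_ge0// ltW.
have gs0 : 0 < gamma + s by lra.
have num : (p - b) * s - \sum_(j < n) q j
    = \sum_(j < n) (p - (b + c j * q j)) * (1 / c j).
  rewrite /s mulr_sumr -sumrB; apply: eq_bigr => j _.
  by field; rewrite gt_eqF.
have num_ge0 : 0 <= (p - b) * s - \sum_(j < n) q j.
  rewrite num; apply: sumr_ge0 => j _; have /andP[h _] := he j.
  by rewrite mulr_ge0// divr_ge0// ltW.
have num_le : (p - b) * s - \sum_(j < n) q j <= E * s.
  rewrite num /s mulr_sumr; apply: ler_sum => j _; have /andP[_ h] := he j.
  by rewrite ler_wpM2r// divr_ge0// ltW.
have Eg : 0 <= E * gamma by rewrite mulr_ge0// ltW.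
have -> : p - (phat * gamma + b * s) / (gamma + s)
    = ((p - b) * s - \sum_(j < n) q j) / (gamma + s).
  by rewrite -hD; field; rewrite gt_eqF.
by rewrite divr_ge0 ?(ltW gs0)//= ler_pdivrMr//; lra.
Qed.

Lemma cvg_of_le_div (R : realType) (f : R -> R) (l B K0 : R) :
  (forall K, K0 < K -> `|l - f K| <= B / K) -> f K @[K --> +oo] --> l.
Proof.
move=> H; apply/cvgrPdist_le => e e0; near=> K.
have K_gt0 : 0 < K by near: K; apply: nbhs_pinfty_gt; exact: num_real.
apply: le_trans (H K _) _.
  by near: K; apply: nbhs_pinfty_gt; exact: num_real.
by rewrite ler_pdivrMr// -ler_pdivrMl//.
Unshelve. all: by end_near. Qed.

Theorem mainTheorem10 (R : realType) (n : nat) (b gamma phat : R)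
    (c : 'I_n -> R) (S : R -> 'I_n -> R -> R) :
  (0 < n)%N ->
  0 < b -> (forall i, 0 < c i) -> 0 < gamma -> 0 < phat -> b <= phat ->
  let C := fun i : 'I_n => quadratic_cost b (c i) in
  let D := affine_demand gamma phat in
  let pstar := fun K : R => clearing_price phat D (S K) in
  let pinf := (phat * gamma + b * \sum_(j < n) 1 / c j)
              / (gamma + \sum_(j < n) 1 / c j) in
  (forall K : R, 0 < K -> nash_equilibrium phat K D C (S K)) ->
  ((1 < n)%N -> pstar K @[K --> +oo] --> pinf) /\
  (pstar K @[K --> +oo] --> pinf ->
   forall i : 'I_n, derive1 (C i) (S K i (pstar K)) @[K --> +oo] --> pinf).
Proof.
move=> n0 b0 c0 g0 phat_gt0 bphat C D pstar pinf NE.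
have clear K : 0 < K -> D (pstar K) = \sum_(j < n) S K j (pstar K).
  move=> K_gt0.
  by case: (clearing_price_clears g0 (ltW phat_gt0) (ltW K_gt0) (NE K K_gt0).1).
set B := 2 * (gamma * phat).
have K_bound K : gamma * phat / b < K -> 0 < K /\ gamma * phat < K * b.
  by move=> h; split; [apply: lt_trans h; rewrite divr_gt0// mulr_gt0
                      | rewrite -ltr_pdivrMr].
have margin K i : (1 < n)%N -> gamma * phat / b < K ->
    0 <= pstar K - (b + c i * S K i (pstar K)) <= B / K.
  move=> n1 /K_bound[K_gt0 Kb].
  exact: (nash_margin_bounds i n1 b0 c0 g0 phat_gt0 bphat K_gt0 Kb (NE K K_gt0)).
have price K : (1 < n)%N -> gamma * phat / b < K ->
    0 <= pstar K - pinf <= B / K.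
  move=> n1 hK; have [K_gt0 _] := K_bound _ hK.
  apply: (competitive_price_bounds g0 c0 _ (clear K K_gt0)).
    by rewrite divr_ge0 ?mulr_ge0 ?ltW.
  by move=> j; exact: margin.
split=> [n1|cvgp i].
  apply: (@cvg_of_le_div _ _ _ B (gamma * phat / b)) => K hK.
  by have /andP[h1 h2] := price K n1 hK; rewrite distrC ger0_norm.
under eq_fun do rewrite derive1_quadratic_cost.
have [n1|n_le1] := ltnP 1 n.
  apply: (@cvg_of_le_div _ _ _ B (gamma * phat / b)) => K hK.
  have /andP[h1 h2] := price K n1 hK.
  have /andP[h3 h4] := margin K i n1 hK.
  by rewrite ler_norml; apply/andP; split; lra.
(* A single player serves the whole demand. *)
have ord_eq0 (j : 'I_n) : val j = 0%N.
  by apply/eqP; rewrite -leqn0 -ltnS (leq_trans (ltn_ord j)).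
have only (F : 'I_n -> R) : \sum_(j < n) F j = F i.
  rewrite (bigD1 i)//= big1 ?addr0// => j /eqP[].
  by apply: val_inj; rewrite !ord_eq0.
have pinfE : pinf = b + c i * (gamma * (phat - pinf)).
  rewrite /pinf !only; field; rewrite !gt_eqF ?c0//.
  by rewrite addr_gt0// ?mulr_gt0.
rewrite pinfE.
have : b + c i * D (pstar K) @[K --> +oo]
    --> b + c i * (gamma * (phat - pinf)).
  apply: cvgD; first exact: cvg_cst.
  apply: cvgMr; apply: cvgMr; apply: cvgB => //; exact: cvg_cst.
apply: cvg_trans; apply: near_eq_cvg; near=> K.
have K_gt0 : 0 < K by near: K; apply: nbhs_pinfty_gt; exact: num_real.
by rewrite clear// only.
Unshelve. all: by end_near. Qed.
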